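(* Let $\mathcal{P}_n\subset\mathbb{R}^n$ be the convex hull of all parking functions of length $n$. For $s$ from $0$ to $n$, let $f_{n-s}$ be the number of $(n-s)$-dimensional faces of $\mathcal{P}_n$. Then $$f_{n-s}=\sum_{\substack{0\le m\le s\\ m\neq 1}}\binom{n}{m}\cdot (s-m)!\cdot S(n-m+1,\,s-m+1),$$ where $S(a,b)$ denotes the Stirling number of the second kind.
   Context: Here $n$ is a positive integer. A sequence $\alpha=(a_1,\dots,a_n)$ with $a_i\in\{1,\dots,n\}$ is a parking function of length $n$ if its weakly increasing rearrangement $b_1\le b_2\le\dots\le b_n$ satisfies $b_i\le i$ for all $i\in\{1,\dots,n\}$. A face of a polytope $\mathcal{P}\subset\mathbb{R}^n$ is a set of the form $\mathcal{P}\cap\{x: c\cdot x=d\}$ where $c\in\mathbb{R}^n$, $d\in\mathbb{R}$ are such that $c\cdot x\le d$ for all $x\in\mathcal{P}$. In particular ($c=0$, $d=0$) $\mathcal{P}$ itself is a face. The Stirling number of the second kind $S(a,b)$ is the number of partitions of an $a$-element set into $b$ nonempty unlabeled blocks.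
   Formalization: The single case n = 1, s = 0 is excluded, because there the claim fails: P_1 = {1} is a point, so f_1 = 0, while the formula gives C(1,0)·0!·S(2,1) = 1. *)

(* Defs.v *)
From mathcomp Require Import all_boot all_order all_algebra.

Set Implicit Arguments.
Unset Strict Implicit.
Unset Printing Implicit Defensive.

(* Stated before [classical_sets] is imported, so that the [set _ | _] and
   [set: _] notations are those of [finset]. *)
Definition stirling2 (a b : nat) : nat :=
  #|[set P : {set {set 'I_a}} | partition P [set: 'I_a] & #|P| == b]|.

From mathcomp Require Import all_classical reals convex.

Import Order.TTheory GRing.Theory Num.Theory.

Local Open Scope classical_set_scope.
Local Open Scope ring_scope.

Definition parking_function (n : nat) (a : n.-tuple nat) : bool :=
  all (fun k => 0 < k <= n)%N a &&
  [forall i : 'I_n, nth 0%N (sort leq a) i <= i.+1]%N.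

Definition convex_hull (R : realType) (n : nat) (A : set 'rV[R]_n) :
    set 'rV[R]_n :=
  smallest (@convex_set R 'rV[R]_n) A.

Definition affine_hull (R : realType) (n : nat) (A : set 'rV[R]_n) :
    set 'rV[R]_n :=
  [set x | exists (k : nat) (w : 'I_k -> R) (v : 'I_k -> 'rV[R]_n),
     [/\ forall i, A (v i), \sum_(i < k) w i = 1
       & x = \sum_(i < k) w i *: v i]].

(* [affine_dim A k] never holds for the empty set (whose dimension is
   conventionally -1), since its affine hull is empty. *)
Definition affine_dim (R : realType) (n : nat) (A : set 'rV[R]_n) (k : nat) :
    Prop :=
  exists (x0 : 'rV[R]_n) (V : {vspace 'rV[R]_n}),
    affine_hull A = [set x0 + v | v in [set v | v \in V]] /\ \dim V = k.

Definition dotp (R : realType) (n : nat) (c x : 'rV[R]_n) : R :=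
  \sum_(i < n) c 0 i * x 0 i.

Definition face (R : realType) (n : nat) (P F : set 'rV[R]_n) : Prop :=
  exists (c : 'rV[R]_n) (d : R),
    (forall x, P x -> dotp c x <= d) /\ F = P `&` [set x | dotp c x = d].

Definition parking_polytope (R : realType) (n : nat) : set 'rV[R]_n :=
  convex_hull [set (\row_(i < n) (tnth a i)%:R : 'rV[R]_n) |
               a in [set a : n.-tuple nat | parking_function a]].
Arguments parking_polytope : clear implicits.

(* Main.v *)
Require Import Defs.
From mathcomp Require Import all_boot all_order all_algebra perm zify ring lra.

(* The face of the parking polytope maximizing [c] depends only on the signs of
   the entries of [c] and on the ordered partition of its positive entries by
   value.  This is recorded by a level map [l]: [l i = 0] when [c i < 0],
   [l i = 1] when [c i = 0], and [l i] is 2 plus the rank of [c i] among the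
   positive values otherwise.  The maximum is attained exactly where [x i = 1]
   on level 0 and where, for each [t > 1], the sum of the [x i] with [l i >= t]
   reaches its upper bound [n + (n - 1) + ...] over parking functions.  These
   conditions are independent, so the face has dimension [n - m - k], for [m]
   indices on level 0 and [k] levels above 1.  Two level maps give the same face
   only if one of them has exactly one index on levels 0 and 1, and such maps
   can be discarded.  Shifting levels by one trades this restriction for
   [m != 1], and the maps with given [m] and [k] are then counted by
   [binom(n, m) * k! * S(n - m + 1, k + 1)]: an extra point marks the block of
   level 1, which may be empty. *)

Set Implicit Arguments.
Unset Strict Implicit.
Unset Printing Implicit Defensive.

(** * Counting level maps *)

Lemma card_in_bij (S T : finType) (A : {set S}) (B : {set T})
    (f : S -> T) (g : T -> S) :
    {in A, forall x, f x \in B} -> {in B, forall y, g y \in A} ->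
    {in A, cancel f g} -> {in B, cancel g f} ->
  #|A| = #|B|.
Proof.
move=> fAB gBA fK gK; have <-: f @: A = B.
  apply/setP=> y; apply/imsetP/idP => [[x Ax ->]|By]; first exact: fAB.
  by exists (g y); rewrite ?gBA ?gK.
by rewrite card_in_imset //; apply: can_in_inj fK.
Qed.

Definition surjections (T U : finType) : {set {ffun T -> U}} :=
  [set f : {ffun T -> U} | [forall y, exists x, f x == y]].

Lemma surjectionsP (T U : finType) (f : {ffun T -> U}) :
  reflect (forall y, exists x, f x = y) (f \in surjections T U).
Proof.
rewrite inE; apply: (iffP forallP) => f_surj y.
  by have /existsP[x /eqP <-] := f_surj y; exists x.
by have [x <-] := f_surj y; apply/existsP; exists x.
Qed.

(* A surjection amounts to an enumeration of the partition into its fibres. *)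
Lemma card_surjections_ord (a b : nat) :
  #|surjections 'I_a 'I_b| = b`! * stirling2 a b.
Proof.
pose fibre (f : {ffun 'I_a -> 'I_b}) := [ffun y => f @^-1: [set y]].
pose Q := [set P : {set {set 'I_a}} | partition P [set: 'I_a] & #|P| == b].
pose im (e : {ffun 'I_b -> {set 'I_a}}) := [set e y | y in 'I_b].
pose E := [set e : {ffun 'I_b -> {set 'I_a}} | injectiveb e & im e \in Q].
have -> : #|surjections 'I_a 'I_b| = #|E|.
  have fibre_inj : injective fibre.
    move=> f1 f2 /ffunP e12; apply/ffunP=> x; have := e12 (f1 x).
    by rewrite !ffunE => /setP/(_ x); rewrite !inE eqxx => /esym/eqP->.
  rewrite -(card_imset (surjections 'I_a 'I_b) fibre_inj); apply: eq_card => e.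
  apply/imsetP/idP => [[f /surjectionsP f_surj ->]|].
    rewrite inE; have inj_f : injective (fibre f).
      move=> y1 y2; rewrite !ffunE; have [x <-] := f_surj y1.
      by move/setP/(_ x); rewrite !inE eqxx => /esym/eqP.
    apply/andP; split; first exact/injectiveP.
    rewrite inE card_imset // card_ord eqxx andbT.
    apply/and3P; split.
    - apply/eqP/setP=> x; rewrite inE; apply/bigcupP.
      by exists (fibre f (f x)); rewrite ?imset_f // ffunE !inE.
    - apply/trivIsetP=> _ _ /imsetP[y1 _ ->] /imsetP[y2 _ ->].
      rewrite (inj_eq inj_f) !ffunE => ne12; rewrite -setI_eq0.
      apply/eqP/setP=> x; rewrite !inE; apply/negbTE/negP.
      by case/andP=> /eqP-> /eqP e12; rewrite e12 eqxx in ne12.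
    - apply/imsetP=> -[y _]; rewrite ffunE; have [x <-] := f_surj y.
      by move/setP/(_ x); rewrite !inE eqxx.
  rewrite !inE => /and3P[/injectiveP inj_e /and3P[/eqP cov_e triv_e e0] _].
  have f_ex x : exists y, x \in e y.
    have: x \in cover (im e) by rewrite cov_e.
    by case/bigcupP=> _ /imsetP[y _ ->]; exists y.
  pose f := [ffun x => xchoose (f_ex x)].
  have f_def x y : (x \in e y) = (f x == y).
    rewrite ffunE; apply/idP/eqP => [xy|<-]; last exact: (xchooseP (f_ex x)).
    have im_e z : e z \in im e by exact: imset_f.
    apply/eqP/negPn/negP => ne.
    have := trivIsetP triv_e _ _ (im_e (xchoose (f_ex x))) (im_e y).
    rewrite (inj_eq inj_e) => /(_ ne) /pred0P/(_ x) /=.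
    by rewrite xy (xchooseP (f_ex x)).
  exists f.
    apply/surjectionsP=> y; have [ey0|[x xy]] := set_0Vmem (e y).
      by case/imsetP: e0; exists y.
    by exists x; apply/eqP; rewrite -f_def.
  by apply/ffunP=> y; apply/setP=> x; rewrite ffunE f_def !inE.
rewrite -sum1_card (partition_big im (mem Q)) /=; last by move=> e; rewrite inE => /andP[].
rewrite /stirling2 -/Q mulnC -sum_nat_const; apply: eq_bigr => P QP.
have cP : #|P| = b by move: (QP); rewrite /= in_set => /andP[_ /eqP].
(* The enumerations of [P] are the injections of ['I_b] into [P]; as [P] has [b] blocks, each of
   them is onto. *)
have -> : b`! = #|P| ^_ #|'I_b| by rewrite cP card_ord ffactnn.
rewrite sum1_card -card_inj_ffuns_on.
apply: eq_card => e; rewrite in_set [LHS]/in_mem /= in_set.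
apply/andP/andP=> [[/andP[inj_e _] /eqP eP]|[eP inj_e]].
  by split=> //; apply/ffun_onP=> y; rewrite -eP imset_f.
have e_im : im e = P.
  apply/eqP; rewrite eqEcard card_imset ?card_ord ?cP ?leqnn ?andbT; last exact/injectiveP.
  by apply/subsetP=> _ /imsetP[y _ ->]; move/ffun_onP: eP; apply.
by rewrite e_im inj_e QP.
Qed.

Lemma card_surjections (T : finType) (b : nat) :
  #|surjections T 'I_b| = b`! * stirling2 #|T| b.
Proof.
rewrite -card_surjections_ord.
pose reindex (h : {ffun T -> 'I_b}) : {ffun 'I_#|T| -> 'I_b} := [ffun i => h (enum_val i)].
pose unindex (h : {ffun 'I_#|T| -> 'I_b}) : {ffun T -> 'I_b} := [ffun x => h (enum_rank x)].
apply: (card_in_bij (f := reindex) (g := unindex)) => [f|f|f _|f _].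
- move=> /surjectionsP f_surj; apply/surjectionsP=> y; have [x <-] := f_surj y.
  by exists (enum_rank x); rewrite ffunE enum_rankK.
- move=> /surjectionsP f_surj; apply/surjectionsP=> y; have [x <-] := f_surj y.
  by exists (enum_val x); rewrite ffunE enum_valK.
- by apply/ffunP=> x; rewrite !ffunE enum_rankK.
- by apply/ffunP=> x; rewrite !ffunE enum_valK.
Qed.

(* All values of a surjection at [x0] are equally frequent. *)
Lemma card_pointed_surjections (T : finType) (x0 : T) (k : nat) :
  #|[set f in surjections T 'I_k.+1 | f x0 == ord0]| = k`! * stirling2 #|T| k.+1.
Proof.
pose S y := [set f in surjections T 'I_k.+1 | f x0 == y].
have cS y : #|S y| = #|S ord0|.
  pose h (f : {ffun T -> 'I_k.+1}) := [ffun x => tperm y ord0 (f x)].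
  have hK : involutive h by move=> f; apply/ffunP=> x; rewrite !ffunE tpermK.
  have h_surj f : f \in surjections T 'I_k.+1 -> h f \in surjections T 'I_k.+1.
    move=> /surjectionsP f_surj; apply/surjectionsP=> z.
    have [x xz] := f_surj (tperm y ord0 z).
    by exists x; rewrite ffunE xz tpermK.
  apply: (card_in_bij (f := h) (g := h)) => [f|f|f _|f _]; rewrite ?hK //.
    by rewrite in_set => /andP[/h_surj fs /eqP f0]; rewrite in_set fs ffunE f0 tpermL eqxx.
  by rewrite in_set => /andP[/h_surj fs /eqP f0]; rewrite in_set fs ffunE f0 tpermR eqxx.
have : k.+1 * #|S ord0| = k.+1 * (k`! * stirling2 #|T| k.+1).
  rewrite mulnA -factS -card_surjections -[LHS](@sum_nat_const_nat 0 k.+1) big_mkord.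
  rewrite -[RHS]sum1_card.
  rewrite (partition_big (fun f : {ffun T -> 'I_k.+1} => f x0) xpredT) //=.
  apply: eq_bigr => y _; rewrite -(cS y) sum1_card; apply: eq_card => f.
  by rewrite in_set.
by move/eqP; rewrite eqn_pmul2l // => /eqP.
Qed.

(** Only levels 0 and 1 may be empty, so [k] counts the blocks of positive entries. *)
Definition level_map (n k : nat) (l : 'I_n -> nat) : bool :=
  [forall i, l i <= k.+1] && [forall t : 'I_k, exists i, l i == t.+2].

Lemma level_mapP (n k : nat) (l : 'I_n -> nat) :
  reflect ((forall i, l i <= k.+1) /\ (forall t, 1 < t <= k.+1 -> exists i, l i = t))
          (level_map k l).
Proof.
apply: (iffP andP) => -[lek hit]; split; [exact/forallP| | exact/forallP|].
  case=> [|[|t]] // /andP[_ tk]; have /existsP[i /eqP <-] := forallP hit (Ordinal (tk : t < k)).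
  by exists i.
apply/forallP=> t; apply/existsP; have [|i <-] := hit t.+2; first by rewrite !ltnS ltn_ord.
by exists i.
Qed.

Definition zeros (n : nat) (l : 'I_n -> nat) : {set 'I_n} := [set i | l i == 0].
Definition lows (n : nat) (l : 'I_n -> nat) : {set 'I_n} := [set i | l i <= 1].

(** Outside [N] the levels lowered by one range over 0 to [k] and may miss only 0. The extra point
    [None], sent to 0, makes the map surjective. *)
Lemma card_level_maps_zeros (n k : nat) (N : {set 'I_n}) : k <= n ->
  #|[set l : {ffun 'I_n -> 'I_n.+2} | (zeros (val \o l) == N) && level_map k (val \o l)]|
  = k`! * stirling2 (n - #|N| + 1) (k + 1).
Proof.
move=> kn; pose T := option {x | x \notin N}.
have -> : n - #|N| + 1 = #|{: T}|.
  have cNC : #|N| + #|[pred x | x \notin N]| = n by rewrite cardC card_ord.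
  by rewrite card_option card_sig addn1 -[X in X - _]cNC addKn.
rewrite addn1 -(card_pointed_surjections (None : T)).
pose f (l : {ffun 'I_n -> 'I_n.+2}) : {ffun T -> 'I_k.+1} :=
  [ffun o => if o is Some x then inord (l (val x)).-1 else ord0].
pose g (h : {ffun T -> 'I_k.+1}) : {ffun 'I_n -> 'I_n.+2} :=
  [ffun x => if insub x is Some u then inord (h (Some u)).+1 else ord0].
have lN (l : {ffun 'I_n -> 'I_n.+2}) x : zeros (val \o l) = N -> (x \in N) = (l x == 0 :> nat).
  by move=> <-; rewrite inE.
have gE h (u : {x | x \notin N}) : g h (val u) = (h (Some u)).+1 :> nat.
  by rewrite ffunE valK inordK // ltnS (leq_trans (ltn_ord _)).
have g0 h x : x \in N -> g h x = 0 :> nat.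
  by move=> xN; rewrite ffunE insubN // negbK.
apply: (card_in_bij (f := f) (g := g)) => [l|h|l|h].
- rewrite in_set => /andP[/eqP zN /level_mapP[lek hit]].
  rewrite in_set !ffunE eqxx andbT; apply/surjectionsP=> -[[|t] tk].
    by exists None; rewrite ffunE; apply: val_inj.
  have [i /= li] := hit t.+2 tk.
  have iN : i \notin N by rewrite (lN _ _ zN) li.
  by exists (Some (Sub i iN)); apply: val_inj; rewrite ffunE SubK li /= inordK.
- case/setIdP=> /surjectionsP h_surj /eqP h0; rewrite in_set; apply/andP; split.
    apply/eqP/setP=> x; rewrite inE /=; case: (boolP (x \in N)) => xN.
      by rewrite g0.
    by have := gE h (Sub x xN); rewrite SubK => ->.
  apply/level_mapP; split=> [i|[|[|t]] // /andP[_ tk]] /=.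
    case: (boolP (i \in N)) => iN; first by rewrite g0.
    by have := gE h (Sub i iN); rewrite SubK => ->; rewrite ltn_ord.
  have [[u|] hu] := h_surj (Ordinal (tk : t.+1 < k.+1)); last by rewrite h0 in hu.
  by exists (val u); rewrite gE hu.
- rewrite in_set => /andP[/eqP zN /level_mapP[lek hit]]; apply/ffunP=> x; apply: val_inj.
  case: (boolP (x \in N)) => xN; first by rewrite /= g0 //;
    move: xN; rewrite (lN _ _ zN) => /eqP.
  have /= -> := gE (f l) (Sub x xN); rewrite ffunE SubK.
  move: xN (lek x); rewrite (lN _ _ zN) /=; case: (nat_of_ord (l x)) => // m _ mk.
  by rewrite inordK.
- case/setIdP=> /surjectionsP h_surj /eqP h0; apply/ffunP=> -[u|]; rewrite ffunE ?h0 //.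
  by rewrite gE /= inord_val.
Qed.

(** For the maps kept in the end, [s] is the codimension of the face. As the levels above 1 are
    occupied, no level exceeds [n + 1], hence the finite codomain. *)
Definition level_maps (n s : nat) : {set {ffun 'I_n -> 'I_n.+2}} :=
  [set l : {ffun 'I_n -> 'I_n.+2} | (#|zeros (val \o l)| <= s) &&
     level_map (s - #|zeros (val \o l)|) (val \o l)].

Lemma card_level_maps (n s : nat) : s <= n ->
  #|[set l in level_maps n s | #|zeros (val \o l)| != 1]| =
  \sum_(0 <= m < s.+1 | m != 1) 'C(n, m) * (s - m)`! * stirling2 (n - m + 1) (s - m + 1).
Proof.
move=> sn; rewrite big_mkord.
rewrite -sum1_card (partition_big
  (fun l : {ffun 'I_n -> 'I_n.+2} => inord #|zeros (val \o l)| : 'I_s.+1)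
  (fun m : 'I_s.+1 => m != 1 :> nat)) /=; last first.
  by move=> l; rewrite !inE => /andP[/andP[zs _] z1]; rewrite inordK.
apply: eq_bigr => m m1.
rewrite (partition_big (fun l : {ffun 'I_n -> 'I_n.+2} => zeros (val \o l))
  (fun N => #|N| == m)) /=; last first.
  by move=> l; rewrite !inE => /andP[/andP[/andP[zs _] z1] /eqP <-]; rewrite inordK.
rewrite -mulnA -[X in 'C(X, _)]card_ord -[X in 'C(X, _)]cardsT -cards_draws -sum_nat_const.
apply: eq_big => [N|N /eqP cN]; first by rewrite inE subsetT.
rewrite -cN -card_level_maps_zeros; last by apply: leq_trans (leq_subr _ _) sn.
rewrite -sum1_card; apply: eq_bigl => l; rewrite !inE.
case: (altP (zeros _ =P N)) => [->|]; rewrite ?andbF //= cN.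
by rewrite -ltnS ltn_ord m1 inord_val eqxx !andbT.
Qed.

Lemma zeros_sub_lows (n : nat) (l : 'I_n -> nat) : zeros l \subset lows l.
Proof. by apply/subsetP=> i; rewrite !inE => /eqP->. Qed.

(* The level maps with [#|lows l| != 1] and those with [#|zeros l| != 1] are
   exchanged by shifting the levels by one wherever they differ. *)
Lemma card_normal_level_maps (n s : nat) : s <= n -> (n, s) <> (1, 0) ->
  #|[set l in level_maps n s | #|lows (val \o l)| != 1]| =
  #|[set l in level_maps n s | #|zeros (val \o l)| != 1]|.
Proof.
move=> sn n1s0.
set G := [set l in _ | _]; set D := [set l in _ | _].
rewrite -(cardsID D G) -(cardsID G D) setIC; congr (_ + _).
have GD (l : {ffun 'I_n -> 'I_n.+2}) : l \in G :\: D -> [/\ #|zeros (val \o l)| = 1, 0 < s,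
    #|lows (val \o l)| != 1 & level_map s.-1 (val \o l)].
  rewrite !inE => /andP[nD /andP[/andP[zs lev] low]]; move: nD.
  rewrite zs lev /= negbK => /eqP z1; rewrite z1 in zs lev.
  by split=> //; rewrite -subn1.
have DG (l : {ffun 'I_n -> 'I_n.+2}) : l \in D :\: G -> [/\ #|zeros (val \o l)| = 0, 0 < s,
    #|lows (val \o l)| = 1 & level_map s (val \o l)].
  rewrite !inE => /andP[nD /andP[/andP[zs lev] z1]]; move: nD.
  rewrite zs lev /= negbK => /eqP low1.
  have z0 : #|zeros (val \o l)| = 0.
    have := subset_leq_card (zeros_sub_lows (val \o l)); rewrite low1.
    by move: (z1 : #|zeros (val \o l)| != 1); case: #|_| => [|[|m]].
  rewrite z0 subn0 in lev; split=> //.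
  (* With [s = 0] every level is at most 1, so all indices are low and [n = 1]: the excluded
     case. *)
  rewrite lt0n; apply/eqP=> s0; apply: n1s0; rewrite s0; congr (_, _).
  rewrite -low1 -[LHS]card_ord -cardsT; congr #|pred_of_set _|.
  by apply/setP=> i; rewrite !inE; case/level_mapP: lev => /(_ i); rewrite s0.
pose up (l : {ffun 'I_n -> 'I_n.+2}) : {ffun 'I_n -> 'I_n.+2} := [ffun i => inord (l i).+1].
pose down (l : {ffun 'I_n -> 'I_n.+2}) : {ffun 'I_n -> 'I_n.+2} := [ffun i => inord (l i).-1].
have upE (l : {ffun 'I_n -> 'I_n.+2}) : l \in G :\: D -> forall i : 'I_n, up l i = (l i).+1 :> nat.
  case/GD=> _ s0 _ /level_mapP[/= le_s _] i; rewrite ffunE inordK //.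
  by have := le_s i; lia.
have downE (l : {ffun 'I_n -> 'I_n.+2}) (i : 'I_n) : down l i = (l i).-1 :> nat.
  by rewrite ffunE inordK // (leq_ltn_trans (leq_pred _)).
have upD (l : {ffun 'I_n -> 'I_n.+2}) : l \in G :\: D -> up l \in D :\: G.
  move=> lGD; have [z1 s0 low /level_mapP[/= le_s hit]] := GD l lGD.
  have uE := upE l lGD.
  have zu : #|zeros (val \o up l)| = 0.
    by apply/eqP; rewrite cards_eq0; apply/eqP/setP=> i; rewrite !inE /= uE.
  have lu : lows (val \o up l) = zeros (val \o l).
    by apply/setP=> i; rewrite !inE /= uE; case: (nat_of_ord (l i)).
  rewrite !inE zu lu z1 /= subn0 andbF /= andbT.
  apply/level_mapP; split=> [i|t tle] /=; first by rewrite uE; have := le_s i; lia.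
  have [t2|t2] := eqVneq t 2; last first.
    by have [|i li] := hit t.-1; [lia|exists i; rewrite uE; lia].
  (* Level 1 of [l] is occupied, because exactly one index is on level 0 while the number of low
     indices is not 1; [up] moves level 1 to level 2. *)
  have [i /andP[i1 i0]] : exists i, (i \in lows (val \o l)) && (i \notin zeros (val \o l)).
    apply/existsP; apply: contraNT low; rewrite negb_exists => /forallP lz.
    suff -> : lows (val \o l) = zeros (val \o l) by rewrite z1.
    apply/eqP; rewrite eqEsubset zeros_sub_lows andbT; apply/subsetP=> i il.
    by have := lz i; rewrite il negbK.
  by exists i; rewrite uE t2; move: i1 i0; rewrite !inE /=; lia.
have downG (l : {ffun 'I_n -> 'I_n.+2}) : l \in D :\: G -> down l \in G :\: D.
  move=> lDG; have [z0 s0 low1 /level_mapP[/= le_s hit]] := DG l lDG.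
  have dE := downE l.
  have zd : zeros (val \o down l) = lows (val \o l).
    by apply/setP=> i; rewrite !inE /= dE; case: (nat_of_ord (l i)) => [|[]].
  have ld : #|lows (val \o down l)| != 1.
    (* Level 2, occupied because [s > 0], drops to level 1, so [down l] has more low indices than
       [l]. *)
    have [|i li] := hit 2; first by lia.
    have: lows (val \o l) \proper lows (val \o down l).
      apply/properP; split; first by apply/subsetP=> j; rewrite !inE /= dE; lia.
      by exists i; rewrite !inE /= ?dE li.
    by move/proper_card; rewrite low1; lia.
  rewrite !inE zd low1 ld s0 /= andbT andbF /=.
  apply/level_mapP; split=> [i|t tle] /=; first by rewrite dE; have := le_s i; lia.
  by have [|i li] := hit t.+1; [lia|exists i; rewrite dE li].
apply: (card_in_bij (f := up) (g := down)) => // l => [lGD|lDG].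
  by apply/ffunP=> i; apply: val_inj; rewrite /= downE upE.
apply/ffunP=> i; apply: val_inj; rewrite /= ffunE downE.
have [z0 _ _ _] := DG l lDG.
have : i \notin zeros (val \o l) by rewrite (cards0_eq z0) inE.
rewrite inE /= -lt0n => li; rewrite prednK // inordK //.
Qed.

(** * Parking functions and permutations *)

Lemma card_ord_ltn (n m : nat) : m <= n -> #|[set i : 'I_n | i < m]| = m.
Proof.
move=> mn; rewrite -sum1_card (eq_bigl (fun i : 'I_n => i < m)) => [|i]; last by rewrite inE.
by rewrite -(big_ord_widen n (fun=> 1)) // sum1_card card_ord.
Qed.

Lemma card_perm_ltn (n m : nat) (p : 'S_n) : m <= n -> #|[set i | p i < m]| = m.
Proof.
move=> mn; rewrite -[RHS](card_ord_ltn mn) -[RHS](card_preimset _ (@perm_inj _ p)).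
by apply: eq_card => i; rewrite !inE.
Qed.

(** Sorting [a] yields the dominating permutation. This form bounds each entry separately, which
    passes directly to sums over sets. *)
Lemma parking_functionP (n : nat) (a : n.-tuple nat) :
  parking_function a <->
  (forall i, 0 < tnth a i) /\ exists p : 'S_n, forall i, tnth a i <= (p i).+1.
Proof.
have sz : size (sort leq a) == n by rewrite size_sort size_tuple.
pose b := Tuple sz; have nth_b (i : 'I_n) : nth 0 (sort leq a) i = tnth b i by rewrite (tnth_nth 0).
split=> [/andP[/allP a_pos /forallP b_le]|[a_pos [p a_le]]].
  split=> [i|]; first by case/andP: (a_pos _ (mem_tnth i a)).
  have: perm_eq a b by rewrite perm_sym perm_sort.
  case/tuple_permP=> p /val_inj ap; exists p => i.
  by rewrite ap tnth_mktuple -nth_b b_le.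
apply/andP; split.
  apply/allP=> _ /tnthP[i ->]; rewrite a_pos (leq_trans (a_le i)) //=.
apply/forallP=> i.
have: perm_eq b a by rewrite perm_sort.
case/tuple_permP=> q /val_inj bq.
(* Pigeonhole: [i + 1] entries have rank at most [i] under [p], but only [i] sorted positions
   precede [i]. *)
have [j ij pj] : exists2 j : 'I_n, i <= j & p (q j) <= i.
  have /subsetPn[j] : ~~ ([set j : 'I_n | (q * p)%g j < i.+1] \subset [set j : 'I_n | j < i]).
    apply/negP=> /subset_leq_card.
    by rewrite card_perm_ltn ?card_ord_ltn ?ltnn // ltnW.
  by rewrite !inE permM -leqNgt ltnS => pj ij; exists j.
apply: leq_trans (_ : nth 0 (sort leq a) j <= _).
  apply: (sorted_leq_nth leq_trans leqnn 0 (sort_sorted leq_total a)) ij;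
  by rewrite inE (eqP sz) ltn_ord.
by rewrite nth_b bq tnth_mktuple (leq_trans (a_le _)).
Qed.

(* This is [n + (n - 1) + ... + (n - k + 1)], the sum of the [k] largest values
   of [p i + 1] over [i < n] for a permutation [p], in the form given by the threshold
   inequality [v <= c + (v - c)] with [c = n - k]. *)
Definition top_sum (n k : nat) : nat := k * (n - k) + \sum_(p < n) (p.+1 - (n - k)).

Definition top_set (n : nat) (p : 'S_n) (A : {set 'I_n}) : Prop :=
  forall i j, i \in A -> j \notin A -> p j < p i.

(** With [c = n - #|A|], each entry [v] satisfies [v + (c - v) = c + (v - c)] for truncated
    subtraction. The two added sums are thus the slack in the bound on the sum over [A]. *)
Lemma top_sumE (n : nat) (p : 'S_n) (A : {set 'I_n}) :
  \sum_(i in A) (p i).+1 + (\sum_(i in A) (n - #|A| - (p i).+1) +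
    \sum_(i in ~: A) ((p i).+1 - (n - #|A|))) = top_sum n #|A|.
Proof.
rewrite /top_sum -sum_nat_const addnA -big_split /=.
rewrite [X in _ = _ + X](reindex_inj (@perm_inj _ p)) /=.
rewrite [X in _ = _ + X](bigID (mem A) xpredT) /= [RHS]addnA -[in RHS]big_split /=; congr (_ + _).
  by apply: eq_bigr => i _; lia.
by apply: eq_bigl => i; rewrite inE.
Qed.

Lemma perm_sum_le (n : nat) (p : 'S_n) (A : {set 'I_n}) :
  \sum_(i in A) (p i).+1 <= top_sum n #|A|.
Proof. by rewrite -(top_sumE p) leq_addr. Qed.

Lemma perm_sum_eq (n : nat) (p : 'S_n) (A : {set 'I_n}) :
  \sum_(i in A) (p i).+1 = top_sum n #|A| <-> top_set p A.
Proof.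
have cA : #|A| + #|~: A| = n by rewrite cardsC card_ord.
split=> [|top].
  rewrite -(top_sumE p) -[LHS]addn0 => /addnI/esym/eqP.
  rewrite addn_eq0 !sum_nat_eq0 => /andP[/forall_inP inA /forall_inP outA] i j iA jA.
  (* Without slack, [p + 1] is at least [n - #|A|] on [A] and at most that outside; injectivity
     makes the separation strict. *)
  have := outA j; rewrite inE jA => /(_ isT)/eqP pj; have /eqP pi := inA i iA.
  have : p j != p i by apply: contraNneq jA => /perm_inj->.
  by rewrite -val_eqE /=; lia.
(* Both slacks vanish by counting: for [i] outside [A], all of [A] ranks above [i]; for [i] in [A],
   the whole complement ranks below [i]. *)
rewrite -(top_sumE p) [X in _ + (X + _)]big1 => [|i iA].
  rewrite [X in _ + (_ + X)]big1 ?addn0 // => i; rewrite inE => iA.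
  have : A \subset ~: [set j | p j < (p i).+1].
    by apply/subsetP=> j jA; rewrite !inE -leqNgt; apply: top.
  move/subset_leq_card; have := cardsC [set j | p j < (p i).+1].
  by rewrite card_perm_ltn // card_ord => ? ?; apply/eqP; rewrite subn_eq0; lia.
have : ~: A \subset [set j | p j < p i].
  by apply/subsetP=> j; rewrite !inE => jA; apply: top.
move/subset_leq_card; rewrite card_perm_ltn; last exact: ltnW.
by move=> ?; apply/eqP; rewrite subn_eq0; lia.
Qed.

Lemma top_sum0 (n : nat) : top_sum n 0 = 0.
Proof. by rewrite /top_sum big1 // => p _; apply/eqP; rewrite subn0 subn_eq0. Qed.

Lemma top_sumS (n : nat) : top_sum n.+1 n.+1 = (top_sum n.+1 n).+1.
Proof.
rewrite /top_sum subnn muln0 subSnn muln1 add0n -addSn.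
rewrite (eq_bigr (fun p : 'I_n.+1 => 1 + p)) => [|p _]; last by rewrite subn0 add1n.
rewrite big_split /= sum_nat_const card_ord muln1; congr (_ + _).
by apply: eq_bigr => p _; rewrite subn1.
Qed.

Lemma exists_monotone_perm (n : nat) (key : 'I_n -> nat) :
  exists p : 'S_n, forall i j, key i < key j -> p i < p j.
Proof.
pose s := sort (relpre key leq) (enum 'I_n).
have ss : size s = n by rewrite size_sort size_enum_ord.
have sE i : i \in s by rewrite mem_sort mem_enum.
have idx_lt i : index i s < n by rewrite -{2}ss index_mem.
have f_inj : injective (fun i => Ordinal (idx_lt i)).
  by move=> i j [eij]; rewrite -[i](nth_index i (sE i)) eij nth_index.
exists (perm f_inj) => i j; rewrite !permE /=; apply: contraTT; rewrite -!leqNgt.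
rewrite leq_eqVlt => /orP[/eqP eij|].
  by rewrite -[i](nth_index i (sE i)) -eij nth_index.
apply: (sorted_ltn_index (leT := relpre key leq)) => //.
  by move=> x y z /=; apply: leq_trans.
by apply: sort_sorted => x y /=; apply: leq_total.
Qed.

(** For arbitrary [D] this need not be an extreme point of the polytope, but such points suffice to
    distinguish the faces and to span them. *)
Definition vertex (n : nat) (p : 'S_n) (D : {set 'I_n}) : n.-tuple nat :=
  [tuple if i \in D then 1 else (p i).+1 | i < n].

Lemma vertex_parking (n : nat) (p : 'S_n) (D : {set 'I_n}) :
  parking_function (vertex p D).
Proof.
apply/parking_functionP; split=> [i|]; first by rewrite tnth_mktuple; case: ifP.
by exists p => i; rewrite tnth_mktuple; case: ifP.
Qed.

Lemma parking_sum_le (n : nat) (a : n.-tuple nat) (A : {set 'I_n}) :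
  parking_function a -> \sum_(i in A) tnth a i <= top_sum n #|A|.
Proof.
case/parking_functionP=> _ [p ap]; apply: leq_trans (perm_sum_le p A).
by apply: leq_sum => i _.
Qed.

(* A clipped entry may stay in a tight sum only if clipping does not change it. *)
Lemma vertex_sum_eq (n : nat) (p : 'S_n) (D A : {set 'I_n}) :
  \sum_(i in A) tnth (vertex p D) i = top_sum n #|A| <->
  top_set p A /\ {in A, forall i, i \in D -> p i = 0 :> nat}.
Proof.
have vle i : tnth (vertex p D) i <= (p i).+1 by rewrite tnth_mktuple; case: ifP.
split=> [sumA|[/perm_sum_eq <- pD]]; last first.
  by apply: eq_bigr => i iA; rewrite tnth_mktuple; case: ifP => // /(pD i iA)->.
have : \sum_(i in A) (p i).+1 <= \sum_(i in A) tnth (vertex p D) i.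
  by rewrite sumA perm_sum_le.
have := leqif_sum (fun i (_ : i \in A) => leqif_geq (vle i)).
move=> /geq_leqif -> /forall_inP pv; split.
  apply/perm_sum_eq; rewrite -sumA; apply: eq_bigr => i /pv; move: (vle i).
  by move=> h1 h2; apply/eqP; rewrite eqn_leq h1 h2.
by move=> i /pv; rewrite tnth_mktuple => + iD; rewrite iD; case: (nat_of_ord (p i)).
Qed.

(** * Vertices determine the level map *)

Definition upper (n : nat) (l : 'I_n -> nat) (t : nat) : {set 'I_n} := [set i | t <= l i].

(** These are the equations of the face of [l], read on integer points. *)
Definition tight (n : nat) (l : 'I_n -> nat) (a : n.-tuple nat) : Prop :=
  (forall i, l i = 0 -> tnth a i = 1) /\
  (forall t, 1 < t -> \sum_(i in upper l t) tnth a i = top_sum n #|upper l t|).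

Definition compatible (n : nat) (l : 'I_n -> nat) (p : 'S_n) : Prop :=
  forall i j, l i < l j -> p i < p j.

Lemma vertex_tight (n : nat) (l : 'I_n -> nat) (p : 'S_n) (D : {set 'I_n}) :
  compatible l p -> zeros l \subset D -> D \subset lows l -> tight l (vertex p D).
Proof.
move=> lp zD Dl; split=> [i li|t t1].
  by rewrite tnth_mktuple (subsetP zD) // inE li.
apply/vertex_sum_eq; split=> [i j|i].
  by rewrite !inE -ltnNge => ti jt; apply: lp; apply: leq_trans ti.
by rewrite inE => ti /(subsetP Dl); rewrite inE; lia.
Qed.

Lemma exists_compatible_max (n : nat) (l : 'I_n -> nat) (j : 'I_n) :
  exists2 p : 'S_n, compatible l p & forall i, i != j -> l i <= l j -> p i < p j.
Proof.
(* Doubling the levels leaves room for a tie-break that puts [j] on top of its own level only. *)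
have [p key_p] := exists_monotone_perm (fun i => l i + l i + (i == j)).
exists p => [i1 i2 l12|i ij lij]; apply: key_p.
  by case: eqP => _; case: eqP => _; rewrite /= ?addn0; lia.
by rewrite eqxx (negbTE ij); lia.
Qed.

(* These vertices span the face of [l]; the inclusion of faces is thereby stated
   without real coordinates. *)
Definition vertices_tight (n : nat) (l l' : 'I_n -> nat) : Prop :=
  forall (p : 'S_n) (D : {set 'I_n}), compatible l p -> zeros l \subset D -> D \subset lows l ->
    tight l' (vertex p D).

(** Applied to [lows l], this gives every low index a low companion. *)
Lemma card_neq1_other (T : finType) (A : {set T}) (i : T) :
  #|A| != 1 -> i \in A -> exists2 j, j \in A & j != i.
Proof.
move=> A1 iA; have : A :\ i != set0.
  by rewrite -card_gt0; move: A1; rewrite (cardsD1 i) iA; case: #|_|.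
by case/set0Pn=> j; rewrite !inE => /andP[ji jA]; exists j.
Qed.

(* Among compatible permutations, [p] may put any prescribed index on top of its
   level, so a set tight at all vertices must be closed upwards for [l]. *)
Lemma tight_upper (n : nat) (l l' : 'I_n -> nat) (t : nat) (i : 'I_n) :
    #|lows l| != 1 -> vertices_tight l l' -> 1 < t -> t <= l' i ->
  1 < l i /\ forall j, l i <= l j -> t <= l' j.
Proof.
move=> low vt t1 ti.
have lowsT p : compatible l p -> top_set p (upper l' t) /\
    {in upper l' t, forall x, x \in lows l -> p x = 0 :> nat}.
  move=> lp; apply/vertex_sum_eq; apply: (vt _ _ lp _ _).2 => //.
  exact: zeros_sub_lows.
have up j : l i <= l j -> t <= l' j.
  move=> lij; case: leqP => // l'j.
  have [p lp pj] := exists_compatible_max l j.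
  have [top _] := lowsT p lp.
  have ij : i != j by apply: contraTneq l'j => <-; rewrite -leqNgt.
  by have := top i j; rewrite !inE ti -ltnNge l'j => /(_ isT isT); have := pj i ij lij; lia.
split=> //; case: ltnP => // li1.
(* If [i] were low, tightness with all low entries clipped would force [p i = 0]. A low companion
   [j] contradicts this: either [i] can be ranked above [j], or [j] has a higher level and [p j = 0]
   as well. *)
have [|j] := card_neq1_other low (i := i); first by rewrite inE.
rewrite inE => lj1 ji; case: (leqP (l j) (l i)) => [lji|lij].
  have [p lp pi] := exists_compatible_max l i.
  have [_ /(_ i)] := lowsT p lp; rewrite !inE ti li1 => /(_ isT isT).
  by have := pi j ji lji; lia.
have [p lp _] := exists_compatible_max l i.
have [_ lo] := lowsT p lp.
have pi0 : p i = 0 :> nat by apply: lo; rewrite inE.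
have pj0 : p j = 0 :> nat by apply: lo; rewrite inE ?up // ltnW.
by case/eqP: ji; apply: (@perm_inj _ p); apply: val_inj; rewrite /= pi0.
Qed.

(** By induction on the level: the levels of [l] from 2 up are all occupied, and [l'] increases
    strictly along them, starting from at least 2. *)
Lemma level_map_le (n k : nat) (l l' : 'I_n -> nat) :
    level_map k l -> (forall i j, 1 < l i -> l j < l i -> l' j < l' i) ->
    (forall i, 1 < l i -> 1 < l' i) ->
  forall i, 1 < l i -> l i <= l' i.
Proof.
case/level_mapP=> le_k hit mono gt1 i; move: {2}(l i) (erefl (l i)) => t.
elim: t i => [i ->|t IH i li] //; rewrite li => t1.
have [t2|t2] := eqVneq t.+1 2; first by rewrite t2 gt1 ?li.
have [|j lj] := hit t; first by have := le_k i; lia.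
have := IH j lj; have := mono i j; lia.
Qed.

(** Rank [i] on top of level 1, above a low companion, and leave it unclipped: its entry then
    exceeds 1, which level 0 of [l'] would forbid. *)
Lemma tight_low (n : nat) (l l' : 'I_n -> nat) (i : 'I_n) :
    #|lows l| != 1 -> vertices_tight l l' -> l i = 1 -> l' i != 0.
Proof.
move=> low vt li; apply/eqP=> l'i.
have ilow : i \in lows l by rewrite inE li.
have [j] := card_neq1_other low ilow; rewrite inE => lj ji.
have [p lp pi] := exists_compatible_max l i.
have pj := pi j ji; rewrite li in pj.
have [||tp _] := vt p (lows l :\ i) lp.
- apply/subsetP=> x; rewrite !inE => lx; apply/andP; split; last by rewrite (eqP lx).
  by apply: contraTneq lx => ->; rewrite li.
- exact: subsetDl.
by have := tp i l'i; rewrite tnth_mktuple !inE eqxx /= => -[]; have := pj lj; lia.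
Qed.

(** Above level 1 the two maps order the indices alike and bound each other; [tight_low] then
    separates level 0 from level 1. *)
Lemma tight_inj (n k k' : nat) (l l' : 'I_n -> nat) :
    level_map k l -> level_map k' l' -> #|lows l| != 1 -> #|lows l'| != 1 ->
    (forall a : n.-tuple nat, parking_function a -> (tight l a <-> tight l' a)) ->
  l =1 l'.
Proof.
move=> lev lev' low low' tt.
have vt : vertices_tight l l'.
  by move=> p D lp zD Dl; apply/tt; [exact: vertex_parking|exact: vertex_tight].
have vt' : vertices_tight l' l.
  by move=> p D lp zD Dl; apply/tt; [exact: vertex_parking|exact: vertex_tight].
have gt1' i : 1 < l' i -> 1 < l i.
  by move=> l'i; case: (tight_upper low vt (leqnn 2) l'i).
have gt1 i : 1 < l i -> 1 < l' i.
  by move=> li; case: (tight_upper low' vt' (leqnn 2) li).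
have mono' i j : 1 < l' i -> l' j < l' i -> l j < l i.
  move=> l'i; case: (tight_upper low vt l'i (leqnn _)) => _ up.
  by apply: contraTT; rewrite -!leqNgt; apply: up.
have mono i j : 1 < l i -> l j < l i -> l' j < l' i.
  move=> li; case: (tight_upper low' vt' li (leqnn _)) => _ up.
  by apply: contraTT; rewrite -!leqNgt; apply: up.
have le' := level_map_le lev' mono' gt1'; have le := level_map_le lev mono gt1.
move=> i; have := le i; have := le' i; have := gt1 i; have := gt1' i.
by have := tight_low low vt (i := i); have := tight_low low' vt' (i := i); lia.
Qed.

(** * Faces of the parking polytope *)

From mathcomp Require Import all_classical interval_inference reals convex.

Import Order.TTheory GRing.Theory Num.Theory.

Local Open Scope classical_set_scope.
Local Open Scope ring_scope.

Definition row_of_tuple (R : realType) (n : nat) (a : n.-tuple nat) : 'rV[R]_n :=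
  \row_(i < n) (tnth a i)%:R.
Arguments row_of_tuple : clear implicits.

Lemma parking_in_polytope (R : realType) (n : nat) (a : n.-tuple nat) :
  parking_function a -> parking_polytope R n (row_of_tuple R n a).
Proof. by move=> pa; apply: sub_gen_smallest; exists a. Qed.

(** A half-space is convex, so it contains the hull once it contains the generators. *)
Lemma polytope_dotp_le (R : realType) (n : nat) (c : 'rV[R]_n) (d : R) :
    (forall a : n.-tuple nat, parking_function a -> dotp c (row_of_tuple R n a) <= d) ->
  forall x, parking_polytope R n x -> dotp c x <= d.
Proof.
move=> cd x; apply: (@smallest_sub _ _ _ [set y | dotp c y <= d]); last first.
  by move=> _ [a pa <-]; apply: cd.
move=> y z t; rewrite !inE /= => yd zd.
have -> : dotp c (conv t y z) = t%:num * dotp c y + (1 - t%:num) * dotp c z.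
  rewrite /dotp !mulr_sumr -big_split; apply: eq_bigr => i _ /=.
  by rewrite !mxE /unstable.onem; ring.
have t0 : 0 <= t%:num by [].
have t1 : t%:num <= 1 by [].
nra.
Qed.

Lemma dotp_indic (R : realType) (n : nat) (A : {set 'I_n}) (x : 'rV[R]_n) :
  dotp (\row_i (i \in A)%:R) x = \sum_(i in A) x 0 i.
Proof.
rewrite [RHS]big_mkcond; apply: eq_bigr => i _; rewrite mxE.
by case: (i \in A); rewrite ?mul1r ?mul0r.
Qed.

Lemma polytope_sum_le (R : realType) (n : nat) (A : {set 'I_n}) (x : 'rV[R]_n) :
  parking_polytope R n x -> \sum_(i in A) x 0 i <= (top_sum n #|A|)%:R.
Proof.
rewrite -dotp_indic; apply: polytope_dotp_le => a pa; rewrite dotp_indic.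
under eq_bigr do rewrite mxE.
by rewrite -natr_sum ler_nat parking_sum_le.
Qed.

Lemma polytope_ge1 (R : realType) (n : nat) (i : 'I_n) (x : 'rV[R]_n) :
  parking_polytope R n x -> 1 <= x 0 i.
Proof.
have dotpE (y : 'rV[R]_n) : dotp (- (delta_mx 0 i)) y = - y 0 i.
  rewrite /dotp (bigD1 i) //= big1 => [|j ji]; rewrite !mxE eqxx ?(negbTE ji) /= ?oppr0 ?mul0r //.
  by rewrite eqxx /= mulN1r addr0.
rewrite -lerN2 -dotpE; apply: polytope_dotp_le => a pa.
have [a_pos _] := (parking_functionP a).1 pa.
by rewrite dotpE lerN2 mxE ler1n.
Qed.

(** Kept apart from the polytope, these affine equations also hold on the affine hull of the
    face. *)
Definition tight_set (R : realType) (n : nat) (l : 'I_n -> nat) : set 'rV[R]_n :=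
  [set x | (forall i, l i = 0%N -> x 0 i = 1) /\
     forall t, (1 < t)%N -> \sum_(i in upper l t) x 0 i = (top_sum n #|upper l t|)%:R].
Arguments tight_set : clear implicits.

Definition level_face (R : realType) (n : nat) (l : 'I_n -> nat) : set 'rV[R]_n :=
  parking_polytope R n `&` tight_set R n l.
Arguments level_face : clear implicits.

Lemma tight_set_row (R : realType) (n : nat) (l : 'I_n -> nat) (a : n.-tuple nat) :
  tight_set R n l (row_of_tuple R n a) <-> tight l a.
Proof.
have sumE (A : {set 'I_n}) :
    \sum_(i in A) row_of_tuple R n a 0 i = (\sum_(i in A) tnth a i)%:R.
  by rewrite natr_sum; apply: eq_bigr => i _; rewrite mxE.
split=> -[t0 t2]; split=> [i|t] lt.
- by have := t0 i lt; rewrite mxE => /eqP; rewrite pnatr_eq1 => /eqP.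
- by have := t2 t lt; rewrite sumE => /eqP; rewrite eqr_nat => /eqP.
- by rewrite mxE t0.
- by rewrite sumE t2.
Qed.

(** The increments that survive are those up to level [l i], and they telescope from [u 1 = 0]. *)
Lemma level_weights (R : realType) (n k : nat) (l : 'I_n -> nat) (u : nat -> R) (i : 'I_n) :
  (0 < l i <= k.+1)%N -> u 1%N = 0 ->
  \sum_(t < k) (u t.+2 - u t.+1) * (i \in upper l t.+2)%:R = u (l i).
Proof.
case E: (l i) => [|m] //= mk u1; rewrite ltnS in mk.
transitivity (\sum_(0 <= t < m) (u t.+2 - u t.+1)).
  rewrite big_mkord (big_ord_widen _ (fun t => u t.+2 - u t.+1) mk) [RHS]big_mkcond.
  apply: eq_bigr => t _; rewrite inE E ltnS.
  by case: ifP; rewrite ?mulr1 ?mulr0.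
by rewrite (telescope_sumr (fun t => u t.+1)) // u1 subr0.
Qed.

(* Abel summation writes [dotp c x] as a combination with positive
   coefficients of the sums of [x] over the upper sets. *)
Lemma dotp_le_tight (R : realType) (n k : nat) (l : 'I_n -> nat) (c : 'rV[R]_n)
    (u : nat -> R) :
    (forall i, (l i <= k.+1)%N) -> u 1%N = 0 ->
    (forall t, (t < k)%N -> u t.+1 < u t.+2) ->
    (forall i, l i = 0%N -> c 0 i < 0) -> (forall i, (0 < l i)%N -> c 0 i = u (l i)) ->
  exists M, forall x, parking_polytope R n x ->
    dotp c x <= M /\ (dotp c x = M <-> tight_set R n l x).
Proof.
move=> lk u1 u_incr c0 cu.
pose top (A : {set 'I_n}) : R := (top_sum n #|A|)%:R.
exists (\sum_(t < k) (u t.+2 - u t.+1) * top (upper l t.+2) + \sum_(i in zeros l) c 0 i).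
move=> x Px; set M := _ + _.
(* The defect [M - dotp c x] is a sum of nonnegative gaps, one per equation of [tight_set], so it
   vanishes only if each gap does. *)
pose gap1 (t : 'I_k) := (u t.+2 - u t.+1) * (top (upper l t.+2) - \sum_(i in upper l t.+2) x 0 i).
pose gap2 i := - c 0 i * (x 0 i - 1).
have dE : M - dotp c x = \sum_t gap1 t + \sum_(i in zeros l) gap2 i.
  have -> : dotp c x = \sum_(t < k) (u t.+2 - u t.+1) * (\sum_(i in upper l t.+2) x 0 i)
      + \sum_(i in zeros l) c 0 i * x 0 i.
    under eq_bigr => t _ do rewrite -dotp_indic mulr_sumr.
    rewrite exchange_big /= [X in _ + X]big_mkcond -big_split; apply: eq_bigr => i _ /=.
    transitivity ((\sum_(t < k) (u t.+2 - u t.+1) * (i \in upper l t.+2)%:R) * x 0 i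
        + (if i \in zeros l then c 0 i * x 0 i else 0)); last first.
      by rewrite mulr_suml; congr (_ + _); apply: eq_bigr => t _; rewrite mxE mulrA.
    have := cu i; rewrite inE; case E: (l i) => [|m] /= ci.
      rewrite big1 ?mul0r ?add0r // => t _; by rewrite inE E mulr0.
    rewrite addr0 level_weights //; last by rewrite lk E.
    by rewrite E -ci.
  rewrite opprD addrACA -!sumrB; congr (_ + _); apply: eq_bigr => i _; rewrite /gap1 /gap2; ring.
have gap1_ge0 t : 0 <= gap1 t.
  by rewrite mulr_ge0 // subr_ge0 ?polytope_sum_le // ltW // u_incr.
have gap2_ge0 i : i \in zeros l -> 0 <= gap2 i.
  rewrite inE => /eqP/c0 ci.
  by rewrite mulr_ge0 ?subr_ge0 ?polytope_ge1 // oppr_ge0 ltW.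
have s1 : 0 <= \sum_t gap1 t by apply: sumr_ge0.
have s2 : 0 <= \sum_(i in zeros l) gap2 i by apply: sumr_ge0.
split; first by rewrite -subr_ge0 dE addr_ge0.
split=> [/eqP|[t0 t2]].
  rewrite eq_sym -subr_eq0 dE paddr_eq0 // => /andP[].
  rewrite !psumr_eq0 // => /allP g1 /allP g2; split=> [i li|[|[|t]] // _].
    have := g2 i (mem_index_enum _); rewrite inE li /= mulf_eq0 oppr_eq0 subr_eq0.
    by rewrite (lt_eqF (c0 i li)) /= => /eqP.
  case: (ltnP t k) => [tk|kt].
    have /= := g1 (Ordinal tk) (mem_index_enum _); rewrite mulf_eq0 !subr_eq0.
    by rewrite (gt_eqF (u_incr t tk)) /= => /eqP.
  have -> : upper l t.+2 = finset.set0.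
    by apply/setP=> i; rewrite !inE; apply/negbTE; rewrite -ltnNge ltnS (leq_trans (lk i)).
  by rewrite big_set0 cards0 top_sum0.
apply/eqP; rewrite eq_sym -subr_eq0 dE !big1 ?addr0 // => [i|t _].
  by rewrite inE => /eqP/t0 xi; rewrite /gap2 xi subrr mulr0.
by rewrite /gap1 t2 // subrr mulr0.
Qed.

Lemma vertex_in_level_face (R : realType) (n : nat) (l : 'I_n -> nat) (p : 'S_n) (D : {set 'I_n}) :
  compatible l p -> zeros l \subset D -> D \subset lows l ->
  level_face R n l (row_of_tuple R n (vertex p D)).
Proof.
move=> lp zD Dl; split; first by apply: parking_in_polytope; exact: vertex_parking.
by apply/tight_set_row; exact: vertex_tight.
Qed.

Lemma level_face_neq0 (R : realType) (n : nat) (l : 'I_n -> nat) :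
  level_face R n l !=set0.
Proof.
have [p lp] := exists_monotone_perm l; exists (row_of_tuple R n (vertex p (lows l))).
by apply: vertex_in_level_face => //; apply: zeros_sub_lows.
Qed.

Lemma level_face_is_face (R : realType) (n k : nat) (l : 'I_n -> nat) :
  level_map k l -> face (parking_polytope R n) (level_face R n l).
Proof.
(* The shift by 1 makes [c] negative on level 0 and zero on level 1. *)
case/level_mapP=> lk _; pose c : 'rV[R]_n := \row_i ((l i)%:R - 1).
have [||||M PM] := @dotp_le_tight R n k l c (fun t => t%:R - 1) lk.
- by rewrite subrr.
- by move=> t _; rewrite ltrD2r ltr_nat.
- by move=> i li; rewrite mxE li sub0r oppr_lt0.
- by move=> i _; rewrite mxE.
exists c, M; split; first by move=> x /PM[].
by apply/seteqP; split=> x [Px]; have [_ cM] := PM x Px; split=> //; apply/cM.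
Qed.

(* The levels of [c] rank its positive values; they are shifted so that levels
   0 and 1 stand for the negative values and for the value 0. *)
Lemma exists_levels (R : realType) (n : nat) (c : 'rV[R]_n) :
  exists k l, level_map k l /\ exists M, forall x, parking_polytope R n x ->
    dotp c x <= M /\ (dotp c x = M <-> tight_set R n l x).
Proof.
pose s := sort <=%R (undup [seq c 0 i | i <- enum 'I_n & 0 < c 0 i]).
have s_uniq : uniq s by rewrite sort_uniq undup_uniq.
have sP r : reflect (exists2 i, 0 < c 0 i & r = c 0 i) (r \in s).
  rewrite mem_sort mem_undup; apply: (iffP mapP) => -[i].
    by rewrite mem_filter => /andP[ci _]; exists i.
  by exists i; rewrite // mem_filter mem_enum andbT.
have s_path : path <%R 0 s.
  rewrite path_sortedE; last exact: lt_trans.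
  apply/andP; split; first by apply/allP => r /sP[i ci ->].
  by rewrite lt_sorted_uniq_le s_uniq sort_le_sorted.
pose l (i : 'I_n) := if c 0 i < 0 then 0%N else if c 0 i == 0 then 1%N else (index (c 0 i) s).+2.
have inS i : 0 < c 0 i -> c 0 i \in s by move=> ci; apply/sP; exists i.
have lpos i : 0 < c 0 i -> l i = (index (c 0 i) s).+2.
  by move=> ci; rewrite /l lt_gtF // gt_eqF.
have lev : level_map (size s) l.
  apply/level_mapP; split=> [i|[|[|t]] // /andP[_ ts]].
    rewrite /l; case: ltgtP => // ci; by rewrite ltnS index_mem inS.
  have /sP[i ci ti] : nth 0 s t \in s by rewrite mem_nth.
  by exists i; rewrite lpos // -ti index_uniq.
exists (size s), l; split=> //; have /level_mapP[lk _] := lev.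
(* Here [u 1] is 0 and [u (t + 2)] is the entry of [s] at position [t]. *)
apply: (dotp_le_tight (u := fun t => nth 0 (0 :: s) t.-1) lk) => //= [t ts|i|i].
- by have /(pathP 0)/(_ _ ts) := s_path.
- by rewrite /l; case: ltgtP.
- rewrite /l; case: ltgtP => // ci _ /=; by rewrite nth_index // inS.
Qed.

Lemma face_level_face (R : realType) (n : nat) (F : set 'rV[R]_n) :
  face (parking_polytope R n) F -> F !=set0 ->
  exists k l, level_map k l /\ F = level_face R n l.
Proof.
move=> [c [d [Pd ->]]] [x0 [Px0 /= cx0]].
have [k [l [lev [M PM]]]] := exists_levels c.
exists k, l; split=> //; have [y [Py ty]] := level_face_neq0 R l.
(* A point of the face gives [d <= M], and a point of the level face gives [M <= d]. *)
have dM : d = M.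
  apply/le_anti/andP; split; first by rewrite -cx0; have [] := PM x0 Px0.
  by have [_ cM] := PM y Py; rewrite -(cM.2 ty); apply: Pd.
by rewrite dM; apply/seteqP; split=> x [Px]; have [_ cM] := PM x Px; split=> //; apply/cM.
Qed.

(* If [j] is the only low element, then on the polytope tightness at level 2
   forces both [x 0 j = 1] and a maximal total sum, so that [j] may as well be
   the bottom block of an ordered partition of the whole index set. *)
Lemma normalize_levels (R : realType) (n k : nat) (l : 'I_n -> nat) :
    level_map k l ->
  exists k' l', [/\ level_map k' l', #|lows l'| != 1%N & level_face R n l = level_face R n l'].
Proof.
move=> lev; have [/eqP/cards1P[j lowj]|] := eqVneq #|lows l| 1%N; last by exists k, l.
have /level_mapP[lk hit] := lev.
have lowE i : (l i <= 1)%N = (i == j) by rewrite -[RHS]finset.in_set1 -lowj inE.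
have lj : (l j <= 1)%N by rewrite lowE.
pose l' i := if i == j then 2%N else (l i).+1.
have l'_gt1 i : (1 < l' i)%N
  by rewrite /l'; case: eqVneq => // /negbTE ij; move: (lowE i); rewrite ij; lia.
have up2 t : (1 < t)%N -> upper l' t.+1 = upper l t.
  move=> t1; apply/setP=> i; rewrite !inE /l'; case: eqVneq => [->|] //; lia.
have lows0 : lows l' = finset.set0.
  by apply/setP=> i; rewrite !inE leqNgt l'_gt1.
have upT : upper l' 2 = [set: 'I_n]%SET by apply/setP=> i; rewrite !inE l'_gt1.
have up1 : upper l 2 = (~: [set j])%SET by apply/setP=> i; rewrite !inE ltnNge lowE.
exists k.+1, l'; split.
- apply/level_mapP; split=> [i|[|[|[|t]]] // /andP[_ tk]].
  + by rewrite /l'; case: eqP => // _; rewrite ltnS lk.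
  + by exists j; rewrite /l' eqxx.
  + have [|i li] := hit t.+2; first exact: tk.
    by exists i; rewrite /l'; case: eqVneq li => [->|_ ->] //; lia.
- by rewrite lows0 cards0.
have n0 : (0 < n)%N by apply: leq_ltn_trans (ltn_ord j).
have cup1 : #|upper l 2| = n.-1 by rewrite up1 cardsC1 card_ord.
have sumT x : \sum_i x 0 i = x 0 j + \sum_(i in upper l 2) x 0 i :> R.
  by rewrite (bigD1 j) //= up1; congr (_ + _); apply: eq_bigl => i; rewrite !inE.
have topS : (top_sum n n)%:R = (top_sum n n.-1)%:R + 1 :> R.
  by rewrite -(prednK n0) top_sumS /= -natr1.
have total x : parking_polytope R n x -> \sum_i x 0 i <= (top_sum n n)%:R.
  move=> /(polytope_sum_le [set: 'I_n]%SET); rewrite cardsT card_ord.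
  by under eq_bigl do rewrite inE.
apply/seteqP; split=> x [Px [t0 t2]]; split=> //; split.
- by move=> i l'i; have := l'_gt1 i; rewrite l'i.
- case=> [|[|[|t]]] // _; last by rewrite up2 // t2.
  rewrite upT cardsT card_ord; under eq_bigl do rewrite inE.
  (* The total is at most [top_sum n n], and at least that because [x 0 j >= 1] while the other
     entries already sum to [top_sum n n.-1]. *)
  apply/le_anti; rewrite total // sumT t2 // cup1 topS addrC lerD2r.
  exact: polytope_ge1.
(* Subtracting the equation of [l'] at level 3 from the one at level 2 leaves [x 0 j = 1]. *)
- have := t2 2 isT; rewrite upT cardsT card_ord; under eq_bigl do rewrite inE.
  rewrite sumT => sx i li; have /eqP -> : i == j by rewrite -lowE li.
  have := t2 3 isT; rewrite up2 // cup1; lra.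
- by move=> t t1; rewrite -up2 // t2 // ltnW.
Qed.

(** * Dimension *)

Definition fcons (T : Type) (k : nat) (x : T) (f : 'I_k -> T) (i : 'I_k.+1) : T :=
  if unlift ord0 i is Some j then f j else x.

Lemma fcons0 (T : Type) (k : nat) (x : T) (f : 'I_k -> T) : fcons x f ord0 = x.
Proof. by rewrite /fcons unlift_none. Qed.

Lemma fconsS (T : Type) (k : nat) (x : T) (f : 'I_k -> T) (j : 'I_k) :
  fcons x f (lift ord0 j) = f j.
Proof. by rewrite /fcons liftK. Qed.

(** Adding the weights [a] at [p] and [- a] at [q] keeps the total weight 1. *)
Lemma affine_hull_shift (R : realType) (n : nat) (F : set 'rV[R]_n) (y p q : 'rV[R]_n) (a : R) :
  affine_hull F y -> F p -> F q -> affine_hull F (y + a *: (p - q)).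
Proof.
move=> [k [w [v [Fv w1 ->]]]] Fp Fq.
exists k.+2, (fcons a (fcons (- a) w)), (fcons p (fcons q v)); split.
- move=> i; rewrite /fcons; case: unliftP => [j _|] //; by case: unliftP => [j' _|].
- rewrite !big_ord_recl !fconsS !fcons0 addrA subrr add0r -w1.
  by apply: eq_bigr => i _; rewrite !fconsS.
- rewrite !big_ord_recl !fconsS !fcons0 scalerBr scaleNr addrC addrA; congr (_ + _).
  by apply: eq_bigr => i _; rewrite !fconsS.
Qed.

Lemma affine_hull_sum_shift (R : realType) (n : nat) (F : set 'rV[R]_n) (I : finType)
    (P : pred I) (y : 'rV[R]_n) (c : I -> R) (w : I -> 'rV[R]_n) :
    affine_hull F y ->
    (forall i, P i -> exists a p q, [/\ F p, F q & w i = a *: (p - q)]) ->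
  affine_hull F (y + \sum_(i | P i) c i *: w i).
Proof.
move=> Fy wF; elim/big_rec: _ y Fy => [|i v /wF[a [p [q [Fp Fq ->]]]] IH] y Fy.
  by rewrite addr0.
by rewrite addrA scalerA; apply/IH/affine_hull_shift.
Qed.

Lemma sub_affine_hull (R : realType) (n : nat) (F : set 'rV[R]_n) : F `<=` affine_hull F.
Proof.
move=> x Fx; exists 1%N, (fun=> 1), (fun=> x).
by split=> //; rewrite big_ord1 ?scale1r.
Qed.

Lemma affine_hull_tight (R : realType) (n : nat) (l : 'I_n -> nat) :
  affine_hull (level_face R n l) `<=` tight_set R n l.
Proof.
move=> _ [k [w [v [Fv w1 ->]]]]; split=> [i li|t t1].
  rewrite summxE -w1; apply: eq_bigr => j _.
  by have [_ [v0 _]] := Fv j; rewrite mxE v0 ?mulr1.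
under eq_bigr do rewrite summxE.
rewrite exchange_big /=; set top := (RHS).
transitivity ((\sum_j w j) * top); last by rewrite w1 mul1r.
rewrite mulr_suml; apply: eq_bigr => j _.
have [_ [_ vt]] := Fv j; rewrite /top -vt // mulr_sumr.
by apply: eq_bigr => i _; rewrite mxE.
Qed.

(** The direction space is recovered from the hull as its set of differences. *)
Lemma affine_dim_unique (R : realType) (n d d' : nat) (F : set 'rV[R]_n) :
  affine_dim F d -> affine_dim F d' -> d = d'.
Proof.
move=> [x [V [hV <-]]] [x' [V' [hV' <-]]].
suff sub (y y' : 'rV[R]_n) (W W' : {vspace 'rV[R]_n}) :
    [set y + v | v in [set v | v \in W]] = [set y' + v | v in [set v | v \in W']] ->
    (W <= W')%VS.
  apply/eqP; rewrite eqn_leq (dimvS (sub _ _ _ _ (etrans (esym hV) hV'))).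
  exact: dimvS (sub _ _ _ _ (etrans (esym hV') hV)).
move=> eW; apply/subvP=> u uW.
have yW v : v \in W -> y + v - y' \in W'.
  move=> vW; have : [set y' + v | v in [set v | v \in W']] (y + v) by rewrite -eW; exists v.
  by move=> [v' /= v'W <-]; rewrite addrC addKr.
have := yW 0 (mem0v _); have := yW u uW; rewrite addr0 => h1 h2.
have -> : u = (y + u - y') - (y - y') by rewrite opprB addrA subrK addrC addKr.
exact: memvB.
Qed.

Lemma affine_dim_neq0 (R : realType) (n d : nat) (F : set 'rV[R]_n) :
  affine_dim F d -> F !=set0.
Proof.
move=> [x [V [hV _]]].
have : affine_hull F (x + 0) by rewrite hV; exists 0 => //=; apply: mem0v.
move=> [[|k] [w [v [Fv w1 _]]]]; last by exists (v ord0).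
by move: w1; rewrite big_ord0 => /eqP; rewrite eq_sym oner_eq0.
Qed.

Definition rep (n : nat) (l : 'I_n -> nat) (i : 'I_n) : 'I_n :=
  odflt i [pick j | l j == l i].

Lemma level_rep (n : nat) (l : 'I_n -> nat) (i : 'I_n) : l (rep l i) = l i.
Proof. by rewrite /rep; case: pickP => [j /eqP|]. Qed.

Lemma rep_eq (n : nat) (l : 'I_n -> nat) (i j : 'I_n) : l i = l j -> rep l i = rep l j.
Proof. by rewrite /rep => ->; case: pickP => // /(_ j); rewrite eqxx. Qed.

Definition block_reps (n : nat) (l : 'I_n -> nat) : {set 'I_n} :=
  [set i | (1 < l i)%N && (rep l i == i)]%SET.

(** These coordinates parametrize the tight set: level 0 is fixed, and each representative is
    determined by the sum of its block. *)
Definition free_coords (n : nat) (l : 'I_n -> nat) : {set 'I_n} :=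
  (~: (zeros l :|: block_reps l))%SET.

Lemma card_block_reps (n k : nat) (l : 'I_n -> nat) :
  level_map k l -> #|block_reps l| = k.
Proof.
case/level_mapP=> lk hit; pose f (i : 'I_n) : 'I_k.+2 := inord (l i).
have fE i : f i = l i :> nat by rewrite inordK // ltnS lk.
have inj_f : {in block_reps l &, injective f}.
  move=> i j; rewrite !inE => /andP[_ /eqP ri] /andP[_ /eqP rj] fij.
  by rewrite -ri -rj; apply: rep_eq; rewrite -!fE fij.
rewrite -(card_in_imset inj_f).
have -> : (f @: block_reps l = ~: [set t : 'I_k.+2 | (t < 2)%N])%SET.
  apply/setP=> t; rewrite !inE -leqNgt; apply/imsetP/idP => [[i]|t2].
    by rewrite inE => /andP[li _] ->; rewrite fE.
  have [|i li] := hit t; first by rewrite t2 -ltnS ltn_ord.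
  exists (rep l i); last by apply: val_inj; rewrite /= fE level_rep.
  by rewrite inE level_rep li t2; apply/eqP/rep_eq/level_rep.
by have := cardsC [set t : 'I_k.+2 | (t < 2)%N]%SET; rewrite card_ord_ltn // card_ord; lia.
Qed.

Lemma card_free_coords (n k : nat) (l : 'I_n -> nat) :
  level_map k l -> #|free_coords l| = (n - (#|zeros l| + k))%N /\ (#|zeros l| + k <= n)%N.
Proof.
move=> /card_block_reps <-; have := cardsC (zeros l :|: block_reps l)%SET.
rewrite card_ord cardsU; have -> : (zeros l :&: block_reps l = finset.set0)%SET.
  by apply/setP=> i; rewrite !inE; case: (l i).
by rewrite cards0 subn0 /free_coords; lia.
Qed.

(** For free [i] these form a basis of the homogeneous tight equations: a unit vector on level 1,
    and above it the difference of the unit vectors of [i] and its representative. *)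
Definition direction (R : realType) (n : nat) (l : 'I_n -> nat) (i : 'I_n) : 'rV[R]_n :=
  \row_j ((i == j)%:R - ((1 < l i)%N && (rep l i == j))%:R).
Arguments direction : clear implicits.

Lemma direction_free_coord (R : realType) (n : nat) (l : 'I_n -> nat) (i j : 'I_n) :
  j \in free_coords l -> direction R n l i 0 j = (i == j)%:R.
Proof.
rewrite !inE negb_or negb_and => /andP[_ jrep]; rewrite mxE.
case: andP => [[li /eqP ri]|_]; last by rewrite subr0.
by move: jrep; rewrite -ri level_rep li (rep_eq (level_rep l i)) eqxx.
Qed.

Definition directions (R : realType) (n : nat) (l : 'I_n -> nat) :
    #|free_coords l|.-tuple 'rV[R]_n :=
  [tuple direction R n l (enum_val i) | i < #|free_coords l|].
Arguments directions : clear implicits.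

Lemma nth_directions (R : realType) (n : nat) (l : 'I_n -> nat) (i : 'I_#|free_coords l|) :
  (directions R n l)`_i = direction R n l (enum_val i).
Proof. by rewrite -tnth_nth tnth_mktuple. Qed.

Lemma free_directions (R : realType) (n : nat) (l : 'I_n -> nat) :
  free (directions R n l).
Proof.
apply/freeP=> c c0 i; have := congr1 (fun v : 'rV[R]_n => v 0 (enum_val i)) c0.
rewrite summxE mxE (bigD1 i) //= big1 => [|j ji]; rewrite mxE nth_directions.
  by rewrite direction_free_coord ?enum_valP // eqxx mulr1 addr0.
rewrite direction_free_coord ?enum_valP // (inj_eq enum_val_inj).
by rewrite (negbTE ji) mulr0.
Qed.

Lemma direction_in_span (R : realType) (n : nat) (l : 'I_n -> nat) (i : 'I_n) :
  i \in free_coords l -> direction R n l i \in <<directions R n l>>%VS.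
Proof.
move=> iI; apply: memv_span; apply/tnthP; exists (enum_rank_in iI i).
by rewrite tnth_mktuple enum_rankK_in.
Qed.

Lemma block_sum0 (R : realType) (n : nat) (l : 'I_n -> nat) (v : 'rV[R]_n) (t : nat) :
    (forall t, (1 < t)%N -> \sum_(i in upper l t) v 0 i = 0) -> (1 < t)%N ->
  \sum_(i | l i == t) v 0 i = 0.
Proof.
move=> v0 t1; have := v0 t t1; rewrite (bigID (fun i => l i == t)) /=.
rewrite [X in _ + X](eq_bigl (mem (upper l t.+1))) => [|i]; last first.
  by rewrite !inE [(t < l i)%N]ltn_neqAle andbC eq_sym.
rewrite [X in _ + X]v0 ?addr0 => [vt|]; last exact: ltnW.
by rewrite -[RHS]vt; apply: eq_bigl => i; rewrite inE; case: eqP => [->|]; rewrite ?leqnn ?andbF.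
Qed.

(** On free coordinates the directions restrict to unit vectors. Elsewhere both sides vanish on
    level 0, and at a representative both equal minus the sum over the rest of its block. *)
Lemma homogeneous_sum (R : realType) (n : nat) (l : 'I_n -> nat) (v : 'rV[R]_n) :
    (forall i, l i = 0%N -> v 0 i = 0) ->
    (forall t, (1 < t)%N -> \sum_(i in upper l t) v 0 i = 0) ->
  v = \sum_(i in free_coords l) v 0 i *: direction R n l i.
Proof.
move=> vz v0; apply/rowP=> j; rewrite summxE.
have [jI|jI] := boolP (j \in free_coords l).
  rewrite (bigD1 j) //= big1 => [|i /andP[_ ij]]; rewrite mxE direction_free_coord //.
    by rewrite eqxx mulr1 addr0.
  by rewrite (negbTE ij) mulr0.
have offj i : i \in free_coords l -> (i == j) = false.
  by move=> iI; apply: contraNF jI => /eqP <-.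
move: (jI); rewrite !inE negbK => /orP[/eqP lj|/andP[lj /eqP rj]].
  rewrite big1 ?vz // => i iI; rewrite !mxE offj // sub0r.
  case: andP => [[li /eqP ri]|_]; last by rewrite oppr0 mulr0.
  by move: li; rewrite -(level_rep l i) ri lj.
have := block_sum0 v0 lj; rewrite (bigD1 j) //= => /eqP; rewrite addr_eq0 => /eqP ->.
rewrite -sumrN big_mkcond [RHS]big_mkcond; apply: eq_bigr => i _.
have [->|ij] := eqVneq i j; first by rewrite andbF (negbTE jI).
rewrite andbT; have [lij|lij] := eqVneq (l i) (l j).
  have rij : rep l i = j by rewrite -rj; apply: rep_eq.
  rewrite !inE lij lj rij (gtn_eqF (ltnW lj)) /= [j == i]eq_sym (negbTE ij) /=.
  by rewrite !mxE (negbTE ij) lij lj rij eqxx sub0r mulrN1.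
case: ifP => // iI; rewrite !mxE (negbTE ij) sub0r.
case: andP => [[li /eqP ri]|_]; last by rewrite oppr0 mulr0.
by case/eqP: lij; rewrite -ri level_rep.
Qed.

(** Above level 1, exchanging the ranks of [i] and its representative stays in the face and moves
    along the direction. On level 1, clipping the entry of [i] does. *)
Lemma free_directionP (R : realType) (n : nat) (l : 'I_n -> nat) (i : 'I_n) :
    #|lows l| != 1%N -> i \in free_coords l ->
  exists a p q, [/\ level_face R n l p, level_face R n l q &
    direction R n l i = a *: (p - q)].
Proof.
move=> low iI; have [s ls si] := exists_compatible_max l i.
move: (iI); rewrite !inE negb_or negb_and => /andP[li0 irep].
case: (ltnP 1 (l i)) irep => [li /= ri|li1 _].
  pose r := rep l i; pose s' := (tperm i r * s)%g.
  have lr : l r = l i := level_rep l i.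
  have ls' : compatible l s'.
    have lt x : l (tperm i r x) = l x by case: tpermP => // ->.
    by move=> x y xy; rewrite /s' !permM; apply: ls; rewrite !lt.
  have nlow x : l x = l i -> x \notin lows l by move=> lx; rewrite inE lx -ltnNge.
  have sir : (s i)%:R - (s r)%:R != 0 :> R.
    by rewrite subr_eq0 eqr_nat val_eqE (inj_eq perm_inj) eq_sym.
  exists ((s i)%:R - (s r)%:R)^-1, (row_of_tuple R n (vertex s (lows l))),
    (row_of_tuple R n (vertex s' (lows l))).
  split; try by apply: vertex_in_level_face; rewrite ?zeros_sub_lows.
  apply/rowP=> j; rewrite !mxE !tnth_mktuple li /= -/r /s' permM.
  case: tpermP => [->|->|/eqP ji /eqP jr].
  - rewrite eqxx (negbTE (nlow _ _)) // (negbTE ri) subr0 -![(nat_of_ord (s _)).+1%:R]natr1.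
    by rewrite opprD addrACA subrr addr0 mulVf.
  - rewrite eqxx (negbTE (nlow _ _)) // eq_sym (negbTE ri) sub0r -![(nat_of_ord (s _)).+1%:R]natr1.
    by rewrite opprD addrACA subrr addr0 -[X in _ * X]opprB mulrN mulVf.
  - by rewrite ![_ == j]eq_sym (negbTE ji) (negbTE jr) !subrr mulr0.
have li : l i = 1%N by apply/eqP; rewrite eqn_leq li1 lt0n.
(* A low companion ranks below [i], so [s i > 0] and clipping really changes the entry. *)
have [|j] := @card_neq1_other _ _ i low; first by rewrite inE li.
rewrite inE => lj ji; have := si j ji; rewrite li => /(_ lj) sij.
have si0 : (s i)%:R != 0 :> R by rewrite pnatr_eq0 -lt0n (leq_ltn_trans _ sij).
exists (s i)%:R^-1, (row_of_tuple R n (vertex s (lows l :\ i)%SET)),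
    (row_of_tuple R n (vertex s (lows l))).
split.
- apply: vertex_in_level_face => //; last exact: subsetDl.
  apply/fintype.subsetP=> x; rewrite !inE => lx; apply/andP; split; last by rewrite (eqP lx).
  by apply: contraTneq lx => ->; rewrite li.
- by apply: vertex_in_level_face; rewrite ?zeros_sub_lows.
apply/rowP=> x; rewrite !mxE !tnth_mktuple li !inE /= subr0 [i == x]eq_sym.
have [->|xi] := eqVneq x i; first by rewrite li /= -[(nat_of_ord (s _)).+1%:R]natr1 addrK mulVf.
by rewrite /= subrr mulr0.
Qed.

(** The tight equations bound the hull from above; the directions, being multiples of differences of
    points of the face, fill it. *)
Lemma affine_dim_level_face (R : realType) (n k : nat) (l : 'I_n -> nat) :
  level_map k l -> #|lows l| != 1%N ->
  affine_dim (level_face R n l) (n - (#|zeros l| + k)).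
Proof.
move=> lev low; have [x0 Fx0] := level_face_neq0 R l; have [_ [x00 x02]] := Fx0.
exists x0, <<directions R n l>>%VS; split; last first.
  by have /eqP := free_directions R l; rewrite size_tuple => ->; have [] := card_free_coords lev.
apply/seteqP; split=> [y /affine_hull_tight[y0 y2]|_ [v vV <-]].
  exists (y - x0); last by rewrite addrC subrK.
  rewrite /= (@homogeneous_sum _ _ l (y - x0)).
  - by apply: rpred_sum => i iI; apply/rpredZ/direction_in_span.
  - by move=> i li; rewrite !mxE y0 // x00 // subrr.
  - move=> t t1; under eq_bigr do rewrite !mxE.
    by rewrite sumrB y2 // x02 // subrr.
rewrite (coord_span (vV : v \in <<directions R n l>>%VS));
apply: affine_hull_sum_shift; first exact: sub_affine_hull.
by move=> i _; have := free_directionP R low (enum_valP i); rewrite -nth_directions.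
Qed.

(** * Counting faces *)

Definition normal_level_maps (n s : nat) : {set {ffun 'I_n -> 'I_n.+2}} :=
  [set l in level_maps n s | #|lows (val \o l)| != 1%N]%SET.

Lemma level_map_bound (n k : nat) (l : 'I_n -> nat) (i : 'I_n) :
  level_map k l -> (l i < n.+2)%N.
Proof.
move=> lev; have [_] := card_free_coords lev.
by case/level_mapP: lev => /(_ i); lia.
Qed.

Lemma faces_eq_image (R : realType) (n s : nat) : (s <= n)%N ->
  [set F : set 'rV[R]_n | face (parking_polytope R n) F /\ affine_dim F (n - s)] =
  [set level_face R n (val \o l) | l in [set` normal_level_maps n s]].
Proof.
move=> sn; apply/seteqP; split=> [F [faceF dimF]|_ [l /= + <-]].
  have [k1 [l1 [lev1 eF1]]] := face_level_face faceF (affine_dim_neq0 dimF).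
  have [k [l [lev low eF]]] := normalize_levels R lev1.
  rewrite {}eF1 {}eF in faceF dimF *.
  (* Both [s] and [#|zeros l| + k] are at most [n], so equal dimensions give equal codimensions. *)
  have ns := affine_dim_unique dimF (affine_dim_level_face R lev low).
  have [_ zk] := card_free_coords lev.
  pose l' : {ffun 'I_n -> 'I_n.+2} := [ffun i => Ordinal (level_map_bound i lev)].
  have -> : l = val \o l' by apply/funext=> i; rewrite /= ffunE.
  exists l' => //=; have ll' : val \o l' = l by apply/funext=> i; rewrite /= ffunE.
  rewrite finset.in_set /level_maps finset.in_set ll' low andbT.
  have ks : (s - #|zeros l| = k)%N by lia.
  by rewrite ks lev andbT; lia.
rewrite finset.in_set /level_maps finset.in_set => /andP[/andP[zs lev] low].
split; first exact: level_face_is_face lev.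
by have := affine_dim_level_face R lev low; rewrite subnKC.
Qed.

(** The parking functions lying on a face already determine its normalized level map. *)
Lemma level_face_inj (R : realType) (n s : nat) :
  {in [set` normal_level_maps n s] &,
    injective (fun l : {ffun 'I_n -> 'I_n.+2} => level_face R n (val \o l))}.
Proof.
move=> l l'; rewrite !inE /normal_level_maps /level_maps /mkset !finset.in_set.
move=> /andP[/andP[_ lev] low] /andP[/andP[_ lev'] low'] eF.
apply/ffunP=> i; apply: val_inj; apply: (tight_inj lev lev' low low') => a pa.
have Pa := @parking_in_polytope R _ _ pa.
split=> /(@tight_set_row R) ta; apply/(@tight_set_row R).
  by have [] : level_face R n (val \o l') (row_of_tuple R n a) by rewrite -eF; split.
by have [] : level_face R n (val \o l) (row_of_tuple R n a) by rewrite eF; split.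
Qed.

Local Close Scope ring_scope.
Local Open Scope card_scope.
Local Open Scope nat_scope.

Lemma card_eq_finset (T : finType) (A : {set T}) : [set` A] #= `I_(#|A|).
Proof.
have -> : [set` A] = enum_val @` [set: 'I_#|A|].
  apply/seteqP; split=> [x /= xA|_ [i _ <-]]; last exact: enum_valP.
  by exists (enum_rank_in xA x); rewrite ?enum_rankK_in.
apply: card_eq_trans (inj_card_eq _) (card_esym card_II).
by move=> i j _ _; apply: enum_val_inj.
Qed.

(** For [n = 1] the polytope is a single point and has no face of dimension 1, whereas the sum at
    [s = 0] equals 1; hence the exclusion of [(1, 0)]. *)
Theorem theorem3p1 (R : realType) (n s : nat) (n_gt0 : 0 < n) (s_le_n : s <= n)
    (not_1_0 : (n, s) <> (1, 0)) :
  [set F : set 'rV[R]_n |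
     face (parking_polytope R n) F /\ affine_dim F (n - s)] #=
  `I_(\sum_(0 <= m < s.+1 | m != 1)
        'C(n, m) * (s - m)`! * stirling2 (n - m + 1) (s - m + 1)).
Proof.
rewrite -card_level_maps // -card_normal_level_maps // faces_eq_image //.
apply: card_eq_trans (card_eq_finset _).
by apply: inj_card_eq; exact: level_face_inj.
Qed.
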